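(* For any mapping $X$ assigning to each $\omega\in\Omega$ a closed set $X(\omega)\subset\mathfrak{X}$ (no measurability of $X$ is assumed), there exists a random closed set $Y$ such that $\mathcal{L}^0(X,\mathcal{F})=\mathcal{L}^0(Y,\mathcal{F})$. If $X$ is convex (respectively, a cone), then $Y$ is also convex (respectively, a cone).
   Context: $\mathfrak{X}$ is a separable real Banach space with its norm topology and Borel $\sigma$-algebra $\mathcal{B}(\mathfrak{X})$; $(\Omega,\mathcal{F},\mathbf{P})$ is a complete probability space. A ($\mathcal{F}$-measurable) random set is a set-valued function $\omega\mapsto Y(\omega)\subset\mathfrak{X}$ (empty values allowed) whose graph $\{(\omega,x):x\in Y(\omega)\}$ belongs to $\mathcal{F}\otimes\mathcal{B}(\mathfrak{X})$; it is called closed (convex, a cone) if $Y(\omega)$ is closed (convex, a cone) for almost all $\omega$. For any set-valued mapping $X$, $\mathcal{L}^0(X,\mathcal{F})$ denotes the family of all $\mathcal{F}$-measurable random elements $\xi$ in $\mathfrak{X}$ such that $\xi(\omega)\in X(\omega)$ for almost all $\omega$ (the measurable selections of $X$); this family may be empty. The set $Y$ is called the measurable version of $X$. *)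

(* Defs.v *)
From HB Require Import structures.
From mathcomp Require Import all_boot all_order all_algebra.
From mathcomp Require Import all_classical all_reals all_analysis.

Set Implicit Arguments.
Unset Strict Implicit.
Unset Printing Implicit Defensive.

Import Order.TTheory GRing.Theory Num.Theory.
Import numFieldNormedType.Exports.

Local Open Scope classical_set_scope.
Local Open Scope ring_scope.

Definition separable_space (T : topologicalType) : Prop :=
  exists2 S : set T, countable S & dense S.

Definition borel_type (R : realType) (E : completeNormedModType R) :=
  g_sigma_algebraType (@open E).

(* The apex is not required, so that the empty set is a cone: set-valued maps
   may take empty values. A nonempty closed cone contains 0. *)
Definition cone_set (R : realType) (E : lmodType R) (A : set E) : Prop :=
  forall (t : R) (x : E), 0 < t -> A x -> A (t *: x).

Section RandomSets.
Context (R : realType) (E : completeNormedModType R).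
Context (d : measure_display) (Omega : measurableType d).
Variable P : probability Omega R.
Implicit Types X Y : Omega -> set E.

(* The graph is measured by the product of the sigma-algebra of Omega and the
   Borel sigma-algebra of E. *)
Definition random_set Y : Prop :=
  measurable [set p : Omega * borel_type E | Y p.1 p.2].

Definition ae_closed Y : Prop := {ae P, forall w, closed (Y w)}.

Definition ae_convex Y : Prop :=
  {ae P, forall w, convex_set (Y w : set (convex_lmodType E))}.

Definition ae_cone Y : Prop := {ae P, forall w, cone_set (Y w)}.

Definition random_closed_set Y : Prop := random_set Y /\ ae_closed Y.

(* L^0(X, F): X is an arbitrary set-valued map, so {w | xi w \in X w} need not
   be measurable; `{ae P, _}` asks that its complement be contained in a
   measurable null set. *)
Definition measurable_selections X : set (Omega -> E) :=
  [set xi | measurable_fun setT (xi : Omega -> borel_type E) /\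
            {ae P, forall w, X w (xi w)}].

End RandomSets.

(* Main.v *)
Require Import Defs.
From HB Require Import structures.
From mathcomp Require Import all_boot all_order all_algebra.
From mathcomp Require Import all_classical all_reals all_analysis.

Set Implicit Arguments.
Unset Strict Implicit.
Unset Printing Implicit Defensive.

Import Order.TTheory GRing.Theory Num.Theory.
Import numFieldNormedType.Exports.

Local Open Scope classical_set_scope.
Local Open Scope ring_scope.

(** The measurable version of X is rebuilt from its selections. If X has no
    measurable selection, Y is empty. Otherwise Y(w) is the closure of
    {xi_n(w) : n}, for a sequence (xi_n) of selections of X which is almost
    surely dense in all of them: every selection f of X satisfies
    f(w) \in closure {xi_n(w) : n} for almost all w ([ae_dense_sequence]).

    Such a sequence exists for any nonempty family L of random elements. Fix a
    countable basis (B_i) of the space. For each i, the events {f \in B_i},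
    f \in L, have an essential supremum which is the union of countably many
    of them ([countable_essential_union]), given by some g_(i,0), g_(i,1), ...
    in L. Almost surely, then, whenever f(w) lies in B_i some g_(i,n)(w) lies in
    B_i too; as this holds for all i at once, f(w) is in the closure of the
    values g_(i,n)(w). The basis also shows that the graph of such a closure is
    measurable ([random_closed_set_closure]).

    Selections of X are thus selections of Y. Conversely the xi_n are countably
    many selections of X and X has closed values, hence Y(w) is a subset of X(w)
    almost surely, and selections of Y are selections of X.

    If X is convex, each combination t xi_i + (1 - t) xi_j is a selection of X,
    hence of Y; letting t be rational leaves countably many almost sure
    statements, so they hold simultaneously, and by continuity Y(w), being the
    closure of the xi_n(w), is convex. Cones are treated in the same way, with
    the multiples exp(q) xi_n, q rational. *)

(** * Closures and dense sets *)

(** This extends an algebraic property from a set to its closure, one variable at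
    a time: the preimage of C is closed and contains D. *)
Lemma closed_comp_closure (T U : topologicalType) (f : T -> U) (D : set T)
    (C : set U) :
  continuous f -> closed C -> (forall x, D x -> C (f x)) ->
  forall x, closure D x -> C (f x).
Proof.
move=> cf cC DC x Dx.
have cfC : closed (f @^-1` C) by apply: preimage_closed => // y _; exact: cf.
have : closure (f @^-1` C) x by apply: closureS Dx => y /DC.
by rewrite -(closure_id _).1.
Qed.

Lemma dense_closure (T : topologicalType) (S : set T) :
  dense S -> closure S = setT.
Proof.
move=> dS; apply/seteqP; split=> // x _ A; rewrite nbhsE => -[U [oU Ux] UA].
have [y [Uy Sy]] := dS U (ex_intro _ x Ux) oU.
by exists y; split=> //; exact: UA.
Qed.

Lemma closed_comp_rat (R : realType) (U : topologicalType) (f : R -> U)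
    (C : set U) :
  continuous f -> closed C -> (forall q : rat, C (f (ratr q))) ->
  forall t, C (f t).
Proof.
move=> cf cC qC t.
have fC x : range (@ratr R) x -> C (f x) by move=> [q _ <-].
apply: (closed_comp_closure cf cC fC).
by rewrite (dense_closure (@dense_rat R)).
Qed.

(** The basis consists of the balls with radii 1/(m + 1) centred at the points
    of a dense sequence. *)
Lemma separable_nat_basis (R : realType) (E : normedModType R) :
  separable_space E -> exists2 B : nat -> set E, (forall n, open (B n)) &
    forall (U : set E) x, open U -> U x -> exists2 n, B n x & B n `<=` U.
Proof.
move=> [S cS dS].
have [s Ss] : exists s : nat -> E, S `<=` range s.
  have /pfcard_geP[S0|[s]] := cS.
    by exists (fun=> 0); rewrite S0.
  by exists s => x Sx; have [n _ <-] := 'surj_s Sx; exists n.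
pose B n : set E :=
  if unpickle n is Some (i, m) then ball (s i) m.+1%:R^-1 else set0.
exists B => [n|U x].
  rewrite /B; case: unpickle => [[i m]|]; last exact: open0.
  exact: ball_open.
rewrite openE => /[apply] /nbhs_ballP[e e0 xeU].
(* Two points of a ball of radius 1/(k + 1) are at distance less than e. *)
have [k] := ltr_add_invr (divr_gt0 e0 (ltr0n R 2)); rewrite add0r => ke.
have k0 : 0 < k.+1%:R^-1 :> R by rewrite invr_gt0.
have [y [xy /Ss [i _ siy]]] : ball x k.+1%:R^-1 `&` S !=set0.
  by apply: dS; [exists x; exact: ballxx|exact: ball_open].
exists (pickle (i, k)); rewrite /B pickleK siy; first exact: ball_sym.
move=> z yz; apply: xeU; rewrite (splitr e).
by apply: (ball_triangle (y := y)); apply: le_ball (ltW ke) _ _.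
Qed.

(** * Convexity and the cone property pass to closures *)

(** The projection of the line onto [0, 1]. Through it the coefficients of
    convex combinations are parametrised by the whole line, in which the rational
    numbers are dense. *)
Definition clamp (R : realType) (t : R) : R := Num.max 0 (Num.min t 1).

Lemma clamp_itv (R : realType) (t : R) : 0 <= clamp t <= 1.
Proof. by rewrite /clamp le_max lexx ge_max ler01 ge_min lexx orbT. Qed.

Lemma clampE (R : realType) (t : R) : 0 <= t <= 1 -> clamp t = t.
Proof. by move=> /andP[t0 t1]; rewrite /clamp min_l// max_r. Qed.

Lemma clamp_continuous (R : realType) : continuous (@clamp R).
Proof.
move=> t.
suff : {for t, continuous ((cst 0 : R -> R^o) \max (idfun \min cst 1))} by [].
apply: continuous_max; first exact: cvg_cst.
apply: continuous_min; first exact: cvg_id.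
exact: cvg_cst.
Qed.

Lemma convex_setE (R : realType) (E : lmodType R) (A : set E) :
  convex_set (A : set (convex_lmodType E)) <->
  forall x y t, 0 <= t <= 1 -> A x -> A y -> A (t *: x + (1 - t) *: y).
Proof.
split=> [cA x y t /andP[t0 t1] Ax Ay|cA x y t].
  by have := cA x y (Itv01 t0 t1) (mem_set Ax) (mem_set Ay); rewrite inE.
rewrite !inE => Ax Ay; apply: cA => //.
by rewrite ge0 le1.
Qed.

(** The hypothesis involves only points of D and rational coefficients, and only
    asks that the combination be in the closure. Continuity in the coefficient,
    then in each of the two points, does the rest. *)
Lemma closure_convex (R : realType) (E : normedModType R) (D : set E) :
  (forall x y (q : rat), D x -> D y ->
    closure D (clamp (ratr q) *: x + (1 - clamp (ratr q)) *: y)) ->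
  convex_set (closure D : set (convex_lmodType E)).
Proof.
move=> DD; apply/convex_setE => x y t t01.
have cD := @closed_closure _ D.
have {}DD a b : D a -> D b -> closure D (t *: a + (1 - t) *: b).
  move=> Da Db; rewrite -(clampE t01).
  pose f t := clamp t *: a + (1 - clamp t) *: b.
  apply: (@closed_comp_rat _ _ f) => //.
    move=> s; apply: cvgD; apply: cvgZr_tmp.
      exact: clamp_continuous.
    by apply: cvgB; [exact: cvg_cst|exact: clamp_continuous].
  by move=> q; exact: DD.
have {}DD a b : closure D a -> D b -> closure D (t *: a + (1 - t) *: b).
  move=> Da Db; pose f a := t *: a + (1 - t) *: b.
  apply: (@closed_comp_closure _ _ f D) => //.
    move=> s; apply: cvgD; last exact: cvg_cst.
    exact: scaler_continuous.
  by move=> c Dc; exact: DD.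
move=> Dx; pose f b := t *: x + (1 - t) *: b.
apply: (@closed_comp_closure _ _ f D) => //.
  move=> s; apply: cvgD; first exact: cvg_cst.
  exact: scaler_continuous.
by move=> c Dc; exact: DD.
Qed.

(** The exponential plays here the role of [clamp]: it carries the dense set of
    rational numbers to a dense set of positive factors. *)
Lemma closure_cone (R : realType) (E : normedModType R) (D : set E) :
  (forall x (q : rat), D x -> closure D (expR (ratr q) *: x)) ->
  cone_set (closure D).
Proof.
move=> DD t x t0.
have cD := @closed_closure _ D.
apply: (@closed_comp_closure _ _ (fun x => t *: x) D) => //.
  exact: scaler_continuous.
move=> a Da; rewrite -(lnK t0).
apply: (@closed_comp_rat _ _ (fun s => expR s *: a)) => //.
  by move=> s; apply: cvgZr_tmp; exact: continuous_expR.
by move=> q; exact: DD.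
Qed.

(** * Borel measurable maps and closed random sets *)

Lemma measurable_fun_borel (R : realType) (E : completeNormedModType R)
    d (T : measurableType d) (f : T -> E) :
  (forall U, open U -> measurable (f @^-1` U)) ->
  measurable_fun setT (f : T -> borel_type E).
Proof.
move=> mf; apply: (@measurability _ _ T (borel_type E) setT f (@open E)) => //.
by move=> _ [U oU <-]; rewrite setTI; exact: mf.
Qed.

Lemma measurable_preimage_open (R : realType) (E : completeNormedModType R)
    d (T : measurableType d) (f : T -> E) U :
  measurable_fun setT (f : T -> borel_type E) -> open U ->
  measurable (f @^-1` U).
Proof.
move=> mf oU; rewrite -[X in measurable X]setTI; apply: mf => //.
exact: sub_sigma_algebra.
Qed.

Lemma measurable_fun_continuous (R : realType) (E : completeNormedModType R)
    d (T : measurableType d) (h : E -> E) (f : T -> E) :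
  continuous h ->
  measurable_fun setT (f : T -> borel_type E) ->
  measurable_fun setT ((fun w => h (f w)) : T -> borel_type E).
Proof.
move=> ch mf; apply: measurable_fun_borel => U oU.
apply: (measurable_preimage_open (U := h @^-1` U)) => //.
by apply: open_comp => // x _; exact: ch.
Qed.

(** An open set of E * E is a countable union of products of basic open sets, so
    joint measurability of f and g reduces to that of each of them; this is
    where separability makes sums of random elements measurable. *)
Lemma measurable_fun_continuous2 (R : realType) (E : completeNormedModType R)
    d (T : measurableType d) (h : E * E -> E) (f g : T -> E) :
  separable_space E -> continuous h ->
  measurable_fun setT (f : T -> borel_type E) ->
  measurable_fun setT (g : T -> borel_type E) ->
  measurable_fun setT ((fun w => h (f w, g w)) : T -> borel_type E).
Proof.
move=> /separable_nat_basis[B oB bB] ch mf mg.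
apply: measurable_fun_borel => U oU.
have -> : (fun w => h (f w, g w)) @^-1` U =
    \bigcup_(p in [set p : nat * nat | B p.1 `*` B p.2 `<=` h @^-1` U])
      (f @^-1` B p.1 `&` g @^-1` B p.2).
  apply/seteqP; split=> [w Uw|w [p pU [fw gw]]]; last exact: (pU (f w, g w)).
  have : nbhs (f w, g w) (h @^-1` U) by apply: ch; exact: open_nbhs_nbhs.
  move=> [[V W]] /= [fV gW] VW.
  move: fV gW; rewrite !nbhsE => -[V' [oV' V'f] V'V] [W' [oW' W'g] W'W].
  have [i Bi BiV] := bB _ _ oV' V'f; have [j Bj BjW] := bB _ _ oW' W'g.
  exists (i, j) => //= -[x y] /= [Bx By]; apply: VW; split => /=.
    exact/V'V/BiV.
  exact/W'W/BjW.
rewrite bigcup_mkcond; apply: countable_bigcupT_measurable.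
  exact: countableP.
move=> p; case: ifP => // _; apply: measurableI.
  exact: measurable_preimage_open.
exact: measurable_preimage_open.
Qed.

(** A point x is in the closure of {xi_n(w) : n} if and only if every basic open
    set that contains x contains some xi_n(w). For each of the countably many
    basic open sets this says that x satisfies a Borel condition or that w
    satisfies a measurable one, hence defines a measurable set of the product. *)
Lemma random_closed_set_closure (R : realType) (E : completeNormedModType R)
    d (T : measurableType d) (P : probability T R) (xi : nat -> T -> E) :
  separable_space E ->
  (forall n, measurable_fun setT (xi n : T -> borel_type E)) ->
  random_closed_set P (fun w => closure (range (xi ^~ w))).
Proof.
move=> sepE mxi; split; last by apply: aeW => w; exact: closed_closure.
have [B oB bB] := separable_nat_basis sepE.
rewrite /random_set.
have -> : [set p : T * borel_type E | closure (range (xi ^~ p.1)) p.2] =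
    \bigcap_i (~` (setT `*` (B i : set (borel_type E))) `|`
               ((\bigcup_n (xi n @^-1` B i)) `*` [set: borel_type E])).
  apply/seteqP; split=> [[w x] /= clx i _|[w x] /= Bx V].
    have [Bx|nBx] := pselect (B i x); last by left => -[].
    have [_ [[n _ <-] Bn]] := clx _ (open_nbhs_nbhs (conj (oB i) Bx)).
    by right; split => //; exists n.
  rewrite nbhsE => -[U [oU Ux] UV]; have [i Bi BiU] := bB _ _ oU Ux.
  have [/= []//|/= [[n _ Bn] _]] := Bx i I.
  by exists (xi n w); split; [exists n|exact/UV/BiU].
apply: bigcapT_measurable => i; apply: measurableU.
  by apply: measurableC; apply: measurableX => //; exact: sub_sigma_algebra.
apply: measurableX => //; apply: bigcupT_measurable => n.
exact: measurable_preimage_open.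
Qed.

(** * Countable families that are essentially exhaustive *)

Lemma ae_forall_count d (T : measurableType d) (R : realType)
    (mu : {measure set T -> \bar R}) (I : countType) (Q : I -> T -> Prop) :
  (forall i, {ae mu, forall w, Q i w}) -> {ae mu, forall w, forall i, Q i w}.
Proof.
move=> aeQ.
have aeQ' n : {ae mu, forall w, if unpickle n is Some i then Q i w else True}.
  by case: (unpickle n) => [i|]; [exact: aeQ|exact: aeW].
have := ae_foralln aeQ'; apply: filterS => w Qw i.
by have := Qw (pickle i); rewrite pickleK.
Qed.

(** The sequence is chosen so that the measure of its union is maximal among all
    countable unions of members of F: adjoining one more member C cannot increase
    this measure, which is finite, so C is almost contained in the union. *)
Lemma countable_essential_union (R : realType) d (T : measurableType d)
    (mu : {finite_measure set T -> \bar R}) (F : set (set T)) :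
  F !=set0 -> F `<=` measurable ->
  exists2 A : nat -> set T, (forall n, F (A n)) &
    forall C, F C -> mu (C `\` \bigcup_n A n) = 0%E.
Proof.
move=> [A0 FA0] mF.
pose S := [set mu (\bigcup_n A n) |
  A in [set A : nat -> set T | forall n, F (A n)]].
have S0 : S != set0.
  by apply/set0P; exists (mu (\bigcup_(n : nat) A0)); exists (fun=> A0).
have [u Su ucvg] := ereal_sup_seq S0.
have /choice[A AP] : forall j, exists A : nat -> set T,
    (forall n, F (A n)) /\ mu (\bigcup_n A n) = u j.
  by move=> j; have [A FA Au] := Su j; exists A.
(* Merging maximising sequences A j into one sequence attains the supremum. *)
pose D n := if unpickle n is Some (j, k) then A j k else A0.
have FD n : F (D n).
  by rewrite /D; case: unpickle => [[j k]|//]; exact: (AP j).1.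
have mD : measurable (\bigcup_n D n).
  by apply: bigcupT_measurable => n; exact/mF.
have supD : (ereal_sup S <= mu (\bigcup_n D n))%E.
  rewrite -(cvg_lim _ ucvg)//; apply: lime_le.
    by apply/cvg_ex; exists (ereal_sup S).
  apply: nearW => j; rewrite -(AP j).2; apply: le_measure; rewrite ?inE//.
    by apply: bigcupT_measurable => n; apply: mF; exact: (AP j).1.
  move=> w [k _ Aw]; exists (pickle (j, k)) => //.
  by rewrite /D pickleK.
exists D => // C FC.
have mC := mF _ FC.
have mCD : measurable (C `\` \bigcup_n D n) by exact: measurableD.
have : (mu (\bigcup_n D n) + mu (C `\` \bigcup_n D n) <= mu (\bigcup_n D n))%E.
  rewrite -measureU//; last by rewrite setDIK.
  apply: le_trans supD; apply: ereal_sup_ubound.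
  exists (fun n => if n is n'.+1 then D n' else C); first by case.
  congr (mu _); apply/seteqP; split=> [w [[|n] _]|w].
  - by have [Dw|nDw] := pselect ((\bigcup_n D n) w); [left|right].
  - by move=> Dw; left; exists n.
  - by move=> [[n _ Dw]|[Cw _]]; [exists n.+1|exists 0%N].
rewrite -[leRHS]adde0 leeD2lE; last exact: fin_num_measure.
by rewrite measure_le0 => /eqP.
Qed.

(** The events {f \in B_i} are exhausted separately for each basic open set B_i;
    the countably many exceptional null sets are then discarded together. *)
Lemma ae_dense_sequence (R : realType) (E : completeNormedModType R)
    d (T : measurableType d) (mu : {finite_measure set T -> \bar R})
    (L : set (T -> E)) :
  separable_space E -> L !=set0 ->
  (forall f, L f -> measurable_fun setT (f : T -> borel_type E)) ->
  exists2 xi : nat -> T -> E, (forall n, L (xi n)) &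
    forall f, L f -> {ae mu, forall w, closure (range (xi ^~ w)) (f w)}.
Proof.
move=> /separable_nat_basis[B oB bB] [f0 Lf0] mL.
have /choice[g gP] : forall i, exists g : nat -> T -> E, (forall n, L (g n)) /\
    forall f, L f -> mu (f @^-1` B i `\` \bigcup_n (g n @^-1` B i)) = 0%E.
  move=> i.
  have [||A FA CA] := @countable_essential_union R d T mu
      [set f @^-1` B i | f in L].
  - by exists (f0 @^-1` B i), f0.
  - by move=> _ [f Lf <-]; apply: measurable_preimage_open => //; exact: mL.
  have /choice[g gA] : forall n, exists f, L f /\ f @^-1` B i = A n.
    by move=> n; have [f Lf fA] := FA n; exists f.
  exists g; split=> [n|f Lf]; first exact: (gA n).1.
  rewrite (eq_bigcupr (fun n _ => (gA n).2)).
  by apply: CA; exists f.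
exists (fun m => if unpickle m is Some (i, n) then g i n else f0).
  by move=> m; case: unpickle => [[i n]|//]; exact: (gP i).1.
move=> f Lf.
have : {ae mu, forall w, forall i : nat, (f @^-1` B i) w ->
    (\bigcup_n (g i n @^-1` B i)) w}.
  apply: ae_foralln => i.
  exists (f @^-1` B i `\` \bigcup_n (g i n @^-1` B i)); split.
  - apply: measurableD; first exact: measurable_preimage_open (mL _ Lf) _.
    apply: bigcupT_measurable => n.
    by apply: measurable_preimage_open => //; apply: mL; exact: (gP i).1.
  - exact: (gP i).2.
  - by move=> w /= /not_implyP[].
apply: filterS => w fB V; rewrite nbhsE => -[U [oU Uf] UV].
have [i Bi BiU] := bB _ _ oU Uf; have [n _ Bn] := fB i Bi.
exists (g i n w); split; last exact/UV/BiU.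
by exists (pickle (i, n)) => //; rewrite pickleK.
Qed.

(** * The measurable version of a closed-valued map *)

Theorem proposition2p8 (R : realType) (E : completeNormedModType R)
    (sepE : separable_space E)
    (d : measure_display) (Omega : measurableType d)
    (P : probability Omega R) (completeP : measure_is_complete P)
    (X : Omega -> set E) (closedX : forall w : Omega, closed (X w)) :
  exists Y : Omega -> set E,
    [/\ random_closed_set P Y,
        measurable_selections P X = measurable_selections P Y,
        ae_convex P X -> ae_convex P Y
      & ae_cone P X -> ae_cone P Y].
Proof.
have [L0|/set0P LN0] := eqVneq (measurable_selections P X) set0.
  exists (fun=> set0); split.
  - split; last by apply: aeW => w; exact: closed0.
    exact: measurable0.
  - rewrite L0; apply/esym/seteqP; split=> // xi [_ xi0].
    (* A selection of the empty map would make the whole space negligible. *)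
    have : {ae P, forall w : Omega, False} by [].
    have Ppos : (0 < P setT)%E by rewrite probability_setT.
    have := ae_properfilter_algebraOfSetsType Ppos.
    by move=> PF /(@filter_ex _ _ PF)[].
  - by move=> _; apply: aeW => w; apply/convex_setE.
  - by move=> _; apply: aeW => w t x.
have [|xi Lxi dxi] := ae_dense_sequence P sepE LN0; first by move=> f [].
exists (fun w => closure (range (xi ^~ w))); split.
- by apply: random_closed_set_closure => // n; exact: (Lxi n).1.
- apply/seteqP; split=> f Lf; first by split; [exact: Lf.1|exact: dxi].
  split; first exact: Lf.1.
  have : {ae P, forall w, forall n, X w (xi n w)}.
    by apply: ae_foralln => n; exact: (Lxi n).2.
  have := Lf.2; apply: filterS2 => w fw Xw.
  have : closure (X w) (f w) by apply: closureS fw => _ [n _ <-].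
  by rewrite -(closure_id _).1.
- move=> cX.
  have : {ae P, forall w, forall p : nat * nat * rat,
      closure (range (xi ^~ w)) (clamp (ratr p.2) *: xi p.1.1 w +
        (1 - clamp (ratr p.2)) *: xi p.1.2 w)}.
    apply: ae_forall_count => -[[i j] q] /=.
    pose h (x : E * E) := clamp (ratr q) *: x.1 + (1 - clamp (ratr q)) *: x.2.
    apply: (dxi (fun w => h (xi i w, xi j w))); split.
      apply: (measurable_fun_continuous2 (h := h)) => //.
      + move=> x; apply: cvgD; apply: cvgZl_tmp;
          [exact: cvg_fst|exact: cvg_snd].
      + exact: (Lxi i).1.
      + exact: (Lxi j).1.
    have := (Lxi i).2; have := (Lxi j).2; move: cX; apply: filterS3.
    move=> w /convex_setE cX Xj Xi; apply: cX => //; exact: clamp_itv.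
  apply: filterS => w H; apply: closure_convex => _ _ q [i _ <-] [j _ <-].
  exact: (H (i, j, q)).
- move=> cX.
  have : {ae P, forall w, forall p : nat * rat,
      closure (range (xi ^~ w)) (expR (ratr p.2) *: xi p.1 w)}.
    apply: ae_forall_count => -[i q] /=.
    apply: (dxi (fun w => expR (ratr q) *: xi i w)); split.
      apply: (measurable_fun_continuous (h := fun x => expR (ratr q) *: x)).
        exact: scaler_continuous.
      exact: (Lxi i).1.
    have := (Lxi i).2; move: cX; apply: filterS2 => w cX Xi.
    by apply: cX => //; exact: expR_gt0.
  apply: filterS => w H; apply: closure_cone => _ q [i _ <-].
  exact: (H (i, q)).
Qed.
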